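(* For each integer $n>1$, the variety $\mathbb{V}(\mathbf{F}_n(\mathbb{Z}))$ is closed under lexicographic products with totally ordered abelian $\ell$-groups; that is, if $\mathbf{H}$ is a totally ordered abelian $\ell$-group and $\mathbf{M}\in\mathbb{V}(\mathbf{F}_n(\mathbb{Z}))$, then $\mathbf{H}\overrightarrow{\times}\mathbf{M}\in\mathbb{V}(\mathbf{F}_n(\mathbb{Z}))$.
   Context: An $\ell$-pregroup is an algebra $(A,\wedge,\vee,\cdot,1,{}^{\ell},{}^{r})$ such that $(A,\wedge,\vee)$ is a lattice, $(A,\cdot,1)$ is a monoid, multiplication is order-preserving in both arguments, and $a^{\ell}a\le 1\le aa^{\ell}$ and $aa^{r}\le 1\le a^{r}a$ for all $a\in A$. Write $x^{\ell^k}$, $x^{r^k}$ for the $k$-fold application of ${}^\ell$, ${}^r$. $\ell$-groups are regarded as $\ell$-pregroups with $x^\ell=x^r=x^{-1}$. For a totally ordered $\ell$-group $\mathbf{H}$ and an $\ell$-pregroup $\mathbf{M}$, the lexicographic product $\mathbf{H}\overrightarrow{\times}\mathbf{M}$ is the $\ell$-pregroup on $H\times M$ with coordinatewise $\cdot$, ${}^\ell$, ${}^r$, unit $(1,1)$, and order $(h_1,a_1)\le(h_2,a_2)$ iff $h_1<h_2$ or ($h_1=h_2$ and $a_1\le a_2$). $\mathbf{F}(\mathbb{Z})$ is the $\ell$-pregroup of all order-preserving maps $f\colon\mathbb{Z}\to\mathbb{Z}$ such that $f^{-1}[\{x\}]$ is finite for every $x\in\mathbb{Z}$, with composition as multiplication,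 the identity map as $1$, the pointwise order, and $f^{\ell}(q)=\min\{p: q\le f(p)\}$, $f^{r}(q)=\max\{p: f(p)\le q\}$. $\mathbf{F}_n(\mathbb{Z})$ is the subalgebra of all $f$ with $f^{\ell^n}=f^{r^n}$; equivalently, all $f\in \mathbf{F}(\mathbb{Z})$ with $f(x+n)=f(x)+n$ for all $x\in\mathbb{Z}$. $\mathbb{V}(\mathcal{K})$ denotes the variety generated by $\mathcal{K}$. *)

(* Defs.v *)
From HB Require Import structures.
From mathcomp Require Import all_boot all_order all_algebra.
From mathcomp Require Import boolp classical_sets functions cardinality.
From mathcomp Require Import zify.

Set Implicit Arguments.
Unset Strict Implicit.
Unset Printing Implicit Defensive.

Import Order.TTheory Num.Theory.

Local Open Scope group_scope.
Local Open Scope order_scope.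

(** A single display is fixed for all l-pregroup orders; in particular it keeps
    them apart from the numerical order of [int]. *)
Fact lpregroup_display : Order.disp_t. Proof. exact: (Order.Disp tt tt). Qed.

#[short(type="latticeMonoidType")]
HB.structure Definition LatticeMonoid :=
  { A of Order.Lattice lpregroup_display A & Monoid A }.

HB.mixin Record isLpregroup A of LatticeMonoid A := {
  ladj : A -> A;
  radj : A -> A;
  mulg_mono_subproof : forall a a' b b' : A, a <= a' -> b <= b' -> a * b <= a' * b';
  ladj_mul_le1_subproof : forall a : A, ladj a * a <= 1;
  le1_mul_ladj_subproof : forall a : A, 1 <= a * ladj a;
  mul_radj_le1_subproof : forall a : A, a * radj a <= 1;
  le1_radj_mul_subproof : forall a : A, 1 <= radj a * a
}.

#[short(type="lpregroupType")]
HB.structure Definition Lpregroup :=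
  { A of LatticeMonoid A & isLpregroup A }.

Section LpregroupTheory.
Variable A : lpregroupType.
Implicit Types a b : A.

Lemma mulg_mono a a' b b' : a <= a' -> b <= b' -> a * b <= a' * b'.
Proof. exact: mulg_mono_subproof. Qed.
Lemma ladj_mul_le1 a : ladj a * a <= 1.
Proof. exact: ladj_mul_le1_subproof. Qed.
Lemma le1_mul_ladj a : 1 <= a * ladj a.
Proof. exact: le1_mul_ladj_subproof. Qed.
Lemma mul_radj_le1 a : a * radj a <= 1.
Proof. exact: mul_radj_le1_subproof. Qed.
Lemma le1_radj_mul a : 1 <= radj a * a.
Proof. exact: le1_radj_mul_subproof. Qed.

Lemma ladj_mulE a b c : (ladj a * b <= c) = (b <= a * c).
Proof.
apply/idP/idP => h.
  rewrite -[leLHS]mul1g (le_trans (mulg_mono (le1_mul_ladj a) (lexx b))) //.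
  by rewrite -mulgA mulg_mono.
rewrite -[leRHS]mul1g; apply: le_trans (mulg_mono (ladj_mul_le1 a) (lexx c)).
by rewrite -mulgA mulg_mono.
Qed.
Lemma radj_mulE a b c : (a * b <= c) = (b <= radj a * c).
Proof.
apply/idP/idP => h.
  rewrite -[leLHS]mul1g (le_trans (mulg_mono (le1_radj_mul a) (lexx b))) //.
  by rewrite -mulgA mulg_mono.
rewrite -[leRHS]mul1g; apply: le_trans (mulg_mono (mul_radj_le1 a) (lexx c)).
by rewrite -mulgA mulg_mono.
Qed.
Lemma eq_mulg_le a b : (forall c d : A, (a * c <= d) = (b * c <= d)) -> a = b.
Proof.
move=> h; apply/le_anti/andP; split.
  by have := h 1 b; rewrite !mulg1 lexx.
by have := h 1 a; rewrite !mulg1 lexx.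
Qed.
Lemma ladjK : cancel (@ladj A) (@radj A).
Proof.
move=> a; apply/le_anti/andP; split.
  have := ladj_mulE a (radj (ladj a)) 1; rewrite mulg1 => <-.
  exact: mul_radj_le1.
have := radj_mulE (ladj a) a 1; rewrite mulg1 => <-; exact: ladj_mul_le1.
Qed.
Lemma radjK : cancel (@radj A) (@ladj A).
Proof.
by move=> a; apply: eq_mulg_le => c d; rewrite ladj_mulE -radj_mulE.
Qed.
Lemma ladj_mul a b : ladj (a * b) = ladj b * ladj a.
Proof.
by apply: eq_mulg_le => c d; rewrite -mulgA !ladj_mulE mulgA.
Qed.
Lemma ladj1 : ladj (1 : A) = 1.
Proof. by apply: eq_mulg_le => c d; rewrite ladj_mulE !mul1g. Qed.
Lemma radj1 : radj (1 : A) = 1.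
Proof. by rewrite -[in LHS]ladj1 ladjK. Qed.
Lemma radj_mul a b : radj (a * b) = radj b * radj a.
Proof. by rewrite -[in LHS](radjK a) -[in LHS](radjK b) -ladj_mul ladjK. Qed.
Lemma ladj_anti a b : a <= b -> ladj b <= ladj a.
Proof.
move=> ab; rewrite -[leLHS]mulg1 ladj_mulE (le_trans (le1_mul_ladj a)) //.
exact: mulg_mono.
Qed.
Lemma radj_anti a b : a <= b -> radj b <= radj a.
Proof.
move=> ab; rewrite -[leRHS]mulg1 -radj_mulE (le_trans _ (mul_radj_le1 b)) //.
exact: mulg_mono.
Qed.
Lemma ladj_meet a b : ladj (a `&` b) = ladj a `|` ladj b.
Proof.
apply/le_anti/andP; split; last by rewrite leUx !ladj_anti ?leIl ?leIr.
rewrite -[leRHS]radjK ladj_anti // lexI.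
by rewrite -{2}(ladjK a) -{3}(ladjK b) !radj_anti ?leUl ?leUr.
Qed.
Lemma radj_meet a b : radj (a `&` b) = radj a `|` radj b.
Proof.
apply/le_anti/andP; split; last by rewrite leUx !radj_anti ?leIl ?leIr.
rewrite -[leRHS]ladjK radj_anti // lexI.
by rewrite -{2}(radjK a) -{3}(radjK b) !ladj_anti ?leUl ?leUr.
Qed.
Lemma ladj_join a b : ladj (a `|` b) = ladj a `&` ladj b.
Proof. by apply: (can_inj radjK); rewrite ladjK radj_meet !ladjK. Qed.
Lemma radj_join a b : radj (a `|` b) = radj a `&` radj b.
Proof. by apply: (can_inj ladjK); rewrite radjK ladj_meet !radjK. Qed.

End LpregroupTheory.

HB.mixin Record Lpregroup_isLgroup A of Lpregroup A & Group A := {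
  ladjE : forall a : A, ladj a = a^-1;
  radjE : forall a : A, radj a = a^-1
}.

#[short(type="lgroupType")]
HB.structure Definition Lgroup :=
  { A of Lpregroup A & Group A & Lpregroup_isLgroup A }.

#[short(type="totalLgroupType")]
HB.structure Definition TotalLgroup :=
  { A of Lgroup A & Order.Total lpregroup_display A }.

Record lpregroup_morphism (A B : lpregroupType) (f : A -> B) : Prop := {
  morph_meet : {morph f : a b / a `&` b};
  morph_join : {morph f : a b / a `|` b};
  morph_mul : {morph f : a b / a * b};
  morph_one : f 1 = 1;
  morph_ladj : {morph f : a / ladj a};
  morph_radj : {morph f : a / radj a}
}.

Section Product.
Variables (I : Type) (A : I -> lpregroupType).

Definition prod_lpregroup : Type := forall i, A i.

HB.instance Definition _ := Choice.copy prod_lpregroup (forall i, A i).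

Implicit Types a b c : prod_lpregroup.

Definition prod_le a b : bool := `[< forall i, a i <= b i >].
Definition prod_meet a b : prod_lpregroup := fun i => a i `&` b i.
Definition prod_join a b : prod_lpregroup := fun i => a i `|` b i.
Definition prod_mul a b : prod_lpregroup := fun i => a i * b i.
Definition prod_one : prod_lpregroup := fun i => 1.
Definition prod_ladj a : prod_lpregroup := fun i => ladj (a i).
Definition prod_radj a : prod_lpregroup := fun i => radj (a i).

Lemma prod_le_refl : reflexive prod_le.
Proof. by move=> a; apply/asboolP. Qed.
Lemma prod_le_anti : antisymmetric prod_le.
Proof.
move=> a b /andP[/asboolP ab /asboolP ba].
by apply: functional_extensionality_dep => i; apply/le_anti; rewrite ab ba.
Qed.
Lemma prod_le_trans : transitive prod_le.
Proof.
move=> b a c /asboolP ab /asboolP bc; apply/asboolP => i.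
exact: le_trans (ab i) (bc i).
Qed.
HB.instance Definition _ := Order.Le_isPOrder.Build lpregroup_display
  prod_lpregroup prod_le_refl prod_le_anti prod_le_trans.

Lemma prod_leE a b : (a <= b) = `[< forall i, a i <= b i >].
Proof. by []. Qed.

Lemma prod_meetP a b c : (a <= prod_meet b c) = (a <= b) && (a <= c).
Proof.
rewrite !prod_leE; apply/asboolP/andP => [h|[/asboolP ab /asboolP ac] i].
  by split; apply/asboolP => i; have := h i; rewrite lexI => /andP[].
by rewrite lexI ab ac.
Qed.
Lemma prod_joinP a b c : (prod_join a b <= c) = (a <= c) && (b <= c).
Proof.
rewrite !prod_leE; apply/asboolP/andP => [h|[/asboolP ac /asboolP bc] i].
  by split; apply/asboolP => i; have := h i; rewrite leUx => /andP[].
by rewrite leUx ac bc.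
Qed.
HB.instance Definition _ := Order.POrder_MeetJoin_isLattice.Build
  lpregroup_display prod_lpregroup prod_meetP prod_joinP.

Lemma prod_mulA : associative prod_mul.
Proof. by move=> a b c; apply: functional_extensionality_dep => i; exact: mulgA. Qed.
Lemma prod_mul1 : left_id prod_one prod_mul.
Proof. by move=> a; apply: functional_extensionality_dep => i; exact: mul1g. Qed.
Lemma prod_mulr1 : right_id prod_one prod_mul.
Proof. by move=> a; apply: functional_extensionality_dep => i; exact: mulg1. Qed.
HB.instance Definition _ :=
  isMonoid.Build prod_lpregroup prod_mulA prod_mul1 prod_mulr1.

Lemma prod_mulg_mono a a' b b' : a <= a' -> b <= b' -> a * b <= a' * b'.
Proof.
move=> /asboolP aa' /asboolP bb'; apply/asboolP => i.
change (a i * b i <= a' i * b' i); exact: mulg_mono.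
Qed.
Lemma prod_ladj_mul_le1 a : prod_ladj a * a <= 1.
Proof. by apply/asboolP => i; exact: (ladj_mul_le1 (a i)). Qed.
Lemma prod_le1_mul_ladj a : 1 <= a * prod_ladj a.
Proof. by apply/asboolP => i; exact: (le1_mul_ladj (a i)). Qed.
Lemma prod_mul_radj_le1 a : a * prod_radj a <= 1.
Proof. by apply/asboolP => i; exact: (mul_radj_le1 (a i)). Qed.
Lemma prod_le1_radj_mul a : 1 <= prod_radj a * a.
Proof. by apply/asboolP => i; exact: (le1_radj_mul (a i)). Qed.
HB.instance Definition _ := isLpregroup.Build prod_lpregroup prod_mulg_mono
  prod_ladj_mul_le1 prod_le1_mul_ladj prod_mul_radj_le1 prod_le1_radj_mul.

End Product.

(** [variety_of K] is the least class of l-pregroups that contains [K] and is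
    closed under homomorphic images, subalgebras (up to isomorphism) and
    arbitrary direct products.  l-pregroups are themselves an equational class,
    so forming these closures inside [lpregroupType] loses nothing. *)
Inductive variety_of (K : lpregroupType -> Prop) : lpregroupType -> Prop :=
| variety_gen A : K A -> variety_of K A
| variety_image (A B : lpregroupType) (f : A -> B) :
    lpregroup_morphism f -> (forall b, exists a, f a = b) ->
    variety_of K A -> variety_of K B
| variety_sub (A B : lpregroupType) (f : A -> B) :
    lpregroup_morphism f -> injective f ->
    variety_of K B -> variety_of K A
| variety_prod (I : Type) (A : I -> lpregroupType) :
    (forall i, variety_of K (A i)) -> variety_of K (prod_lpregroup A).

Section Lexicographic.
Variables (H : totalLgroupType) (M : lpregroupType).

Definition lexprod : Type := (H * M)%type.

HB.instance Definition _ := Choice.copy lexprod (H * M)%type.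

Implicit Types p q s : lexprod.

Definition lex_le p q : bool :=
  (p.1 < q.1) || ((p.1 == q.1) && (p.2 <= q.2)).
Definition lex_meet p q : lexprod :=
  if p.1 < q.1 then p else if q.1 < p.1 then q else (p.1, p.2 `&` q.2).
Definition lex_join p q : lexprod :=
  if p.1 < q.1 then q else if q.1 < p.1 then p else (p.1, p.2 `|` q.2).
Definition lex_mul p q : lexprod := (p.1 * q.1, p.2 * q.2).
Definition lex_one : lexprod := (1, 1).
Definition lex_ladj p : lexprod := (ladj p.1, ladj p.2).
Definition lex_radj p : lexprod := (radj p.1, radj p.2).

Lemma lex_le_refl : reflexive lex_le.
Proof. by move=> p; rewrite /lex_le eqxx lexx orbT. Qed.
Lemma lex_le_anti : antisymmetric lex_le.
Proof.
move=> [h a] [k b]; rewrite /lex_le /=.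
by case: (ltgtP h k) => //= -> /andP[ab ba]; congr (_, _); apply/le_anti/andP.
Qed.
Lemma lex_le_trans : transitive lex_le.
Proof.
move=> [h a] [k b] [l c]; rewrite /lex_le /=.
move=> /orP[kh|/andP[/eqP-> ba]] /orP[hl|/andP[/eqP<- ac]].
- by rewrite (lt_trans kh hl).
- by rewrite kh.
- by rewrite hl.
- by rewrite eqxx (le_trans ba ac) orbT.
Qed.
HB.instance Definition _ := Order.Le_isPOrder.Build lpregroup_display
  lexprod lex_le_refl lex_le_anti lex_le_trans.

Lemma lex_leE p q : (p <= q) = (p.1 < q.1) || ((p.1 == q.1) && (p.2 <= q.2)).
Proof. by []. Qed.

Lemma lex_meetP p q s : (p <= lex_meet q s) = (p <= q) && (p <= s).
Proof.
case: p q s => [h a] [k b] [l c]; rewrite !lex_leE /lex_meet /=.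
case: (ltgtP k l) => [kl|lk|<-] /=.
- case: (ltgtP h k) => [hk|//|-> /=]; first by rewrite (lt_trans hk kl).
  by rewrite kl andbT.
- case: (ltgtP h l) => [hl|//|-> /=]; first by rewrite (lt_trans hl lk).
    by rewrite andbF.
  by rewrite lk.
- by case: (ltgtP h k) => //= _; rewrite lexI.
Qed.
Lemma lex_joinP p q s : (lex_join p q <= s) = (p <= s) && (q <= s).
Proof.
case: p q s => [h a] [k b] [l c]; rewrite !lex_leE /lex_join /=.
case: (ltgtP h k) => [hk|kh|<-] /=.
- case: (ltgtP k l) => [kl|lk|<- /=]; first by rewrite (lt_trans hk kl).
    by rewrite andbF.
  by rewrite hk.
- case: (ltgtP h l) => [hl|//|<- /=]; first by rewrite (lt_trans kh hl).
  by rewrite kh andbT.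
- by case: (ltgtP h l) => //= _; rewrite leUx.
Qed.
HB.instance Definition _ := Order.POrder_MeetJoin_isLattice.Build
  lpregroup_display lexprod lex_meetP lex_joinP.

Lemma lex_mulA : associative lex_mul.
Proof. by move=> p q s; rewrite /lex_mul /= !mulgA. Qed.
Lemma lex_mul1 : left_id lex_one lex_mul.
Proof. by case=> h a; rewrite /lex_mul /= !mul1g. Qed.
Lemma lex_mulr1 : right_id lex_one lex_mul.
Proof. by case=> h a; rewrite /lex_mul /= !mulg1. Qed.
HB.instance Definition _ :=
  isMonoid.Build lexprod lex_mulA lex_mul1 lex_mulr1.

Lemma lex_mulg_mono p p' q q' : p <= p' -> q <= q' -> p * q <= p' * q'.
Proof.
case: p p' q q' => [h a] [h' a'] [k b] [k' b']; rewrite !lex_leE /=.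
move=> /orP[hh|/andP[/eqP<- aa]] /orP[kk|/andP[/eqP<- bb]]; apply/orP.
- left; rewrite lt_neqAle (mulg_mono (ltW hh) (ltW kk)) andbT.
  apply: contraTneq hh => e.
  rewrite -leNgt -[leLHS](mulgK k') -e -[leRHS](mulgK k').
  by do 2?[apply: mulg_mono => //]; exact: ltW.
- left; rewrite lt_neqAle (mulg_mono (ltW hh) (lexx k)) andbT.
  by apply: contraTneq hh => /mulIg->; rewrite ltxx.
- left; rewrite lt_neqAle (mulg_mono (lexx h) (ltW kk)) andbT.
  by apply: contraTneq kk => /mulgI->; rewrite ltxx.
- by right; rewrite eqxx mulg_mono.
Qed.
Lemma lex_ladj_mul_le1 p : lex_ladj p * p <= 1.
Proof. by rewrite lex_leE /= ladjE mulVg eqxx ladj_mul_le1 orbT. Qed.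
Lemma lex_le1_mul_ladj p : 1 <= p * lex_ladj p.
Proof. by rewrite lex_leE /= ladjE mulgV eqxx le1_mul_ladj orbT. Qed.
Lemma lex_mul_radj_le1 p : p * lex_radj p <= 1.
Proof. by rewrite lex_leE /= radjE mulgV eqxx mul_radj_le1 orbT. Qed.
Lemma lex_le1_radj_mul p : 1 <= lex_radj p * p.
Proof. by rewrite lex_leE /= radjE mulVg eqxx le1_radj_mul orbT. Qed.
HB.instance Definition _ := isLpregroup.Build lexprod lex_mulg_mono
  lex_ladj_mul_le1 lex_le1_mul_ladj lex_mul_radj_le1 lex_le1_radj_mul.

End Lexicographic.

(** The default value [0] is never reached on the sets used below. *)
Definition int_min (S : set int) : int :=
  xget 0%R [set p | S p /\ forall q, S q -> p <= q]%classic.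
Definition int_max (S : set int) : int :=
  xget 0%R [set p | S p /\ forall q, S q -> q <= p]%classic.

Record FZ := mkFZ {
  FZ_fun :> int -> int;
  FZ_mono : {homo FZ_fun : x y / x <= y};
  FZ_finite : forall x : int, finite_set (FZ_fun @^-1` [set x])%classic
}.

HB.instance Definition _ := gen_eqMixin FZ.
HB.instance Definition _ := gen_choiceMixin FZ.

Lemma FZ_ext (f g : FZ) : f =1 g -> f = g.
Proof.
case: f g => [f fm ff] [g gm gf] /= /funext e; case: _ / e gm gf => gm gf.
by rewrite (Prop_irrelevance fm gm) (Prop_irrelevance ff gf).
Qed.

Lemma finite_int_itv (a b : int) :
  finite_set [set x | a <= x /\ x <= b]%classic.
Proof.
apply: (@sub_finite_set _ _
  ((fun k : nat => (a + k%:Z)%R) @` `I_(absz (b - a)%R).+1)%classic).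
  by move=> x /= [ax xb]; exists (absz (x - a)%R); lia.
exact/finite_image/finite_II.
Qed.

Lemma infinite_int_ge (a : int) : ~ finite_set [set x | a <= x]%classic.
Proof.
move=> fin; apply: infinite_nat.
have /finite_preimage : {in ((fun k : nat => (a + k%:Z)%R) @^-1`
    [set x | a <= x])%classic &, injective (fun k : nat => (a + k%:Z)%R)}.
  by move=> i j _ _; lia.
move=> /(_ fin); congr finite_set; apply/seteqP; split => // k _ /=; lia.
Qed.

Lemma infinite_int_le (a : int) : ~ finite_set [set x | x <= a]%classic.
Proof.
move=> /(finite_image (@GRing.opp int)) fin; apply: (@infinite_int_ge (- a)%R).
by apply: sub_finite_set fin => x /= ax; exists (- x)%R; lia.
Qed.

Lemma FZ_ubounded (f : FZ) q : exists p, q <= f p.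
Proof.
have step x : exists y, f x < f y.
  apply: contrapT => h; apply: (@infinite_int_ge x).
  apply: sub_finite_set (FZ_finite f (f x)) => y /= xy.
  apply/eqP; rewrite eq_le (FZ_mono f xy) andbT leNgt; apply/negP => xy'.
  by apply: h; exists y.
have many (k : nat) : exists p, (f 0 + k%:Z <= f p)%R.
  elim: k => [|k [p hp]]; first by exists 0%R; lia.
  by have [y] := step p; exists y; lia.
have [p hp] := many (absz (q - f 0)%R); exists p; lia.
Qed.

Lemma FZ_lbounded (f : FZ) q : exists p, f p <= q.
Proof.
have step x : exists y, f y < f x.
  apply: contrapT => h; apply: (@infinite_int_le x).
  apply: sub_finite_set (FZ_finite f (f x)) => y /= xy.
  apply/eqP; rewrite eq_le (FZ_mono f xy) /= leNgt; apply/negP => xy'.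
  by apply: h; exists y.
have many (k : nat) : exists p, (f p <= f 0 - k%:Z)%R.
  elim: k => [|k [p hp]]; first by exists 0%R; lia.
  by have [y] := step p; exists y; lia.
have [p hp] := many (absz (q - f 0)%R); exists p; lia.
Qed.

Lemma unbounded_finite (f : int -> int) : {homo f : x y / x <= y} ->
  (forall q, exists p, q <= f p) -> (forall q, exists p, f p <= q) ->
  forall x : int, finite_set (f @^-1` [set x])%classic.
Proof.
move=> fm fu fl y.
have [u hu] := fu (y + 1)%R; have [l hl] := fl (y - 1)%R.
apply: sub_finite_set (finite_int_itv l u) => x /= fx; split.
  by rewrite leNgt; apply/negP => /ltW /fm; lia.
by rewrite leNgt; apply/negP => /ltW /fm; lia.
Qed.

Lemma int_minP (S : set int) (p a : int) : S p -> (forall q, S q -> a <= q) ->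
  S (int_min S) /\ forall q, S q -> int_min S <= q.
Proof.
move=> Sp Sa; apply: (@xgetPex _ 0%R
  [set p | S p /\ forall q, S q -> p <= q]%classic).
have ex : exists k : nat, `[< S (a + k%:Z)%R >].
  exists (absz (p - a)%R); apply/asboolP.
  by have -> : (a + (absz (p - a)%R)%:Z = p)%R by have := Sa p Sp; lia.
case: (ex_minnP ex) => m /asboolP Sm hm; exists (a + m%:Z)%R; split => // q Sq.
have := hm (absz (q - a)%R); have aq := Sa q Sq.
have -> : (a + (absz (q - a)%R)%:Z = q)%R by lia.
by move=> /(_ (asboolT Sq)); lia.
Qed.

Lemma int_maxP (S : set int) (p a : int) : S p -> (forall q, S q -> q <= a) ->
  S (int_max S) /\ forall q, S q -> q <= int_max S.
Proof.
move=> Sp Sa; apply: (@xgetPex _ 0%R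
  [set p | S p /\ forall q, S q -> q <= p]%classic).
have ex : exists k : nat, `[< S (a - k%:Z)%R >].
  exists (absz (a - p)%R); apply/asboolP.
  by have -> : (a - (absz (a - p)%R)%:Z = p)%R by have := Sa p Sp; lia.
case: (ex_minnP ex) => m /asboolP Sm hm; exists (a - m%:Z)%R; split => // q Sq.
have := hm (absz (a - q)%R); have aq := Sa q Sq.
have -> : (a - (absz (a - q)%R)%:Z = q)%R by lia.
by move=> /(_ (asboolT Sq)); lia.
Qed.

Section FZstructure.
Implicit Types f g h : FZ.

Definition FZ_le f g : bool := `[< forall x, f x <= g x >].

Lemma FZ_le_refl : reflexive FZ_le.
Proof. by move=> f; apply/asboolP. Qed.
Lemma FZ_le_anti : antisymmetric FZ_le.
Proof.
move=> f g /andP[/asboolP fg /asboolP gf].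
by apply: FZ_ext => x; apply/le_anti; rewrite fg gf.
Qed.
Lemma FZ_le_trans : transitive FZ_le.
Proof.
move=> g f h /asboolP fg /asboolP gh; apply/asboolP => x.
exact: le_trans (fg x) (gh x).
Qed.
HB.instance Definition _ := Order.Le_isPOrder.Build lpregroup_display
  FZ FZ_le_refl FZ_le_anti FZ_le_trans.

Lemma FZ_leP f g : reflect (forall x, f x <= g x) (f <= g).
Proof. exact: asboolP. Qed.

Lemma FZ_meet_mono f g : {homo (fun x => f x `&` g x) : x y / x <= y}.
Proof. by move=> x y xy; rewrite leI2 ?FZ_mono. Qed.
Lemma FZ_meet_finite f g (x : int) :
  finite_set ((fun x => (f x `&` g x)%O) @^-1` [set x])%classic.
Proof.
apply: unbounded_finite x => [|q|q]; first exact: FZ_meet_mono.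
- have [u hu] := FZ_ubounded f q; have [v hv] := FZ_ubounded g q.
  exists (u `|` v); rewrite lexI (le_trans hu) ?(le_trans hv) //.
    by rewrite FZ_mono ?leUr.
  by rewrite FZ_mono ?leUl.
- by have [u hu] := FZ_lbounded f q; exists u; rewrite leIx2 ?hu.
Qed.
Definition FZ_meet f g : FZ := mkFZ (@FZ_meet_mono f g) (@FZ_meet_finite f g).

Lemma FZ_join_mono f g : {homo (fun x => f x `|` g x) : x y / x <= y}.
Proof. by move=> x y xy; rewrite leU2 ?FZ_mono. Qed.
Lemma FZ_join_finite f g (x : int) :
  finite_set ((fun x => (f x `|` g x)%O) @^-1` [set x])%classic.
Proof.
apply: unbounded_finite x => [|q|q]; first exact: FZ_join_mono.
- by have [u hu] := FZ_ubounded f q; exists u; rewrite lexU2 ?hu.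
- have [u hu] := FZ_lbounded f q; have [v hv] := FZ_lbounded g q.
  exists (u `&` v); rewrite leUx (le_trans _ hu) ?(le_trans _ hv) //.
    by rewrite FZ_mono ?leIr.
  by rewrite FZ_mono ?leIl.
Qed.
Definition FZ_join f g : FZ := mkFZ (@FZ_join_mono f g) (@FZ_join_finite f g).

Lemma FZ_meetP f g h : (f <= FZ_meet g h) = (f <= g) && (f <= h).
Proof.
apply/FZ_leP/andP => [le|[/FZ_leP fg /FZ_leP fh] x].
  by split; apply/FZ_leP => x; have := le x; rewrite lexI => /andP[].
by rewrite lexI fg fh.
Qed.
Lemma FZ_joinP f g h : (FZ_join f g <= h) = (f <= h) && (g <= h).
Proof.
apply/FZ_leP/andP => [le|[/FZ_leP fh /FZ_leP gh] x].
  by split; apply/FZ_leP => x; have := le x; rewrite leUx => /andP[].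
by rewrite leUx fh gh.
Qed.
HB.instance Definition _ := Order.POrder_MeetJoin_isLattice.Build
  lpregroup_display FZ FZ_meetP FZ_joinP.

Lemma FZ_one_mono : {homo (id : int -> int) : x y / x <= y}.
Proof. by []. Qed.
Lemma FZ_one_finite (x : int) : finite_set (id @^-1` [set x])%classic.
Proof. exact: finite_set1. Qed.
Definition FZ_one : FZ := mkFZ FZ_one_mono FZ_one_finite.

Lemma FZ_mul_mono f g : {homo f \o g : x y / x <= y}.
Proof. by move=> x y xy; rewrite /= !FZ_mono. Qed.
Lemma FZ_mul_finite f g (x : int) : finite_set ((f \o g) @^-1` [set x])%classic.
Proof.
apply: unbounded_finite x => [|q|q]; first exact: FZ_mul_mono.
- have [u hu] := FZ_ubounded f q; have [v hv] := FZ_ubounded g u.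
  by exists v; rewrite (le_trans hu) // FZ_mono.
- have [u hu] := FZ_lbounded f q; have [v hv] := FZ_lbounded g u.
  by exists v; rewrite (le_trans _ hu) // FZ_mono.
Qed.
Definition FZ_mul f g : FZ := mkFZ (@FZ_mul_mono f g) (@FZ_mul_finite f g).

Lemma FZ_mulA : associative FZ_mul. Proof. by move=> f g h; exact: FZ_ext. Qed.
Lemma FZ_mul1 : left_id FZ_one FZ_mul. Proof. by move=> f; exact: FZ_ext. Qed.
Lemma FZ_mulr1 : right_id FZ_one FZ_mul. Proof. by move=> f; exact: FZ_ext. Qed.
HB.instance Definition _ := isMonoid.Build FZ FZ_mulA FZ_mul1 FZ_mulr1.

Definition FZ_ladj_fun f (q : int) : int := int_min [set p | q <= f p]%classic.
Definition FZ_radj_fun f (q : int) : int := int_max [set p | f p <= q]%classic.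

Lemma FZ_ladj_funP f q :
  q <= f (FZ_ladj_fun f q) /\ forall p, q <= f p -> FZ_ladj_fun f q <= p.
Proof.
have [u hu] := FZ_ubounded f q; have [l hl] := FZ_lbounded f (q - 1)%R.
apply: (@int_minP [set p | q <= f p]%classic u l) => //= p qp.
by rewrite leNgt; apply/negP => /ltW /(FZ_mono f); lia.
Qed.
Lemma FZ_radj_funP f q :
  f (FZ_radj_fun f q) <= q /\ forall p, f p <= q -> p <= FZ_radj_fun f q.
Proof.
have [u hu] := FZ_ubounded f (q + 1)%R; have [l hl] := FZ_lbounded f q.
apply: (@int_maxP [set p | f p <= q]%classic l u) => //= p qp.
by rewrite leNgt; apply/negP => /ltW /(FZ_mono f); lia.
Qed.

Lemma FZ_ladj_mono f : {homo FZ_ladj_fun f : x y / x <= y}.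
Proof.
move=> x y xy; have [_ hx] := FZ_ladj_funP f x; have [hy _] := FZ_ladj_funP f y.
exact/hx/(le_trans xy).
Qed.
Lemma FZ_ladj_finite f (x : int) :
  finite_set (FZ_ladj_fun f @^-1` [set x])%classic.
Proof.
apply: unbounded_finite x => [|q|q]; first exact: FZ_ladj_mono.
- exists (f q + 1)%R; have [h _] := FZ_ladj_funP f (f q + 1)%R.
  by rewrite leNgt; apply/negP => /ltW /(FZ_mono f); lia.
- by exists (f q); have [_] := FZ_ladj_funP f (f q); apply.
Qed.
Definition FZ_ladj f : FZ := mkFZ (@FZ_ladj_mono f) (@FZ_ladj_finite f).

Lemma FZ_radj_mono f : {homo FZ_radj_fun f : x y / x <= y}.
Proof.
move=> x y xy; have [hx _] := FZ_radj_funP f x; have [_ hy] := FZ_radj_funP f y.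
exact/hy/(le_trans hx).
Qed.
Lemma FZ_radj_finite f (x : int) :
  finite_set (FZ_radj_fun f @^-1` [set x])%classic.
Proof.
apply: unbounded_finite x => [|q|q]; first exact: FZ_radj_mono.
- by exists (f q); have [_] := FZ_radj_funP f (f q); apply.
- exists (f q - 1)%R; have [h _] := FZ_radj_funP f (f q - 1)%R.
  by rewrite leNgt; apply/negP => /ltW /(FZ_mono f); lia.
Qed.
Definition FZ_radj f : FZ := mkFZ (@FZ_radj_mono f) (@FZ_radj_finite f).

Lemma FZ_mulg_mono f f' g g' : f <= f' -> g <= g' -> f * g <= f' * g'.
Proof.
move=> /FZ_leP ff' /FZ_leP gg'; apply/FZ_leP => x.
exact: le_trans (ff' (g x)) (FZ_mono f' (gg' x)).
Qed.
Lemma FZ_ladj_mul_le1 f : FZ_ladj f * f <= 1.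
Proof.
by apply/FZ_leP => x; have [_] := FZ_ladj_funP f (f x); exact.
Qed.
Lemma FZ_le1_mul_ladj f : 1 <= f * FZ_ladj f.
Proof. by apply/FZ_leP => x; have [] := FZ_ladj_funP f x. Qed.
Lemma FZ_mul_radj_le1 f : f * FZ_radj f <= 1.
Proof. by apply/FZ_leP => x; have [] := FZ_radj_funP f x. Qed.
Lemma FZ_le1_radj_mul f : 1 <= FZ_radj f * f.
Proof.
by apply/FZ_leP => x; have [_] := FZ_radj_funP f (f x); exact.
Qed.
HB.instance Definition _ := isLpregroup.Build FZ FZ_mulg_mono
  FZ_ladj_mul_le1 FZ_le1_mul_ladj FZ_mul_radj_le1 FZ_le1_radj_mul.

End FZstructure.

Section Periodic.
Variables (A : lpregroupType) (n : nat).
Implicit Types a b : A.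

Definition periodic : {pred A} :=
  [pred a | iter n (@ladj A) a == iter n (@radj A) a].

Lemma periodicP a :
  reflect (iter n (@ladj A) a = iter n (@radj A) a) (a \in periodic).
Proof. exact: eqP. Qed.

Lemma periodic_meet : {in periodic &, forall a b, a `&` b \in periodic}.
Proof.
have itl k a b : iter k (@ladj A) (a `&` b) =
    (if odd k then Order.join else Order.meet)
      (iter k (@ladj A) a) (iter k (@ladj A) b).
  by elim: k => //= k ->; case: odd; rewrite /= (ladj_meet, ladj_join).
have itr k a b : iter k (@radj A) (a `&` b) =
    (if odd k then Order.join else Order.meet)
      (iter k (@radj A) a) (iter k (@radj A) b).
  by elim: k => //= k ->; case: odd; rewrite /= (radj_meet, radj_join).
by move=> a b /periodicP pa /periodicP pb; apply/periodicP; rewrite itl itr pa pb.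
Qed.
Lemma periodic_join : {in periodic &, forall a b, a `|` b \in periodic}.
Proof.
have itl k a b : iter k (@ladj A) (a `|` b) =
    (if odd k then Order.meet else Order.join)
      (iter k (@ladj A) a) (iter k (@ladj A) b).
  by elim: k => //= k ->; case: odd; rewrite /= (ladj_meet, ladj_join).
have itr k a b : iter k (@radj A) (a `|` b) =
    (if odd k then Order.meet else Order.join)
      (iter k (@radj A) a) (iter k (@radj A) b).
  by elim: k => //= k ->; case: odd; rewrite /= (radj_meet, radj_join).
by move=> a b /periodicP pa /periodicP pb; apply/periodicP; rewrite itl itr pa pb.
Qed.
Lemma periodic_one : 1 \in periodic.
Proof.
have itl k : iter k (@ladj A) 1 = 1 by elim: k => //= k ->; exact: ladj1.
have itr k : iter k (@radj A) 1 = 1 by elim: k => //= k ->; exact: radj1.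
by apply/periodicP; rewrite itl itr.
Qed.
Lemma periodic_mul : {in periodic &, forall a b, a * b \in periodic}.
Proof.
have itl k a b : iter k (@ladj A) (a * b) =
    (if odd k then iter k (@ladj A) b * iter k (@ladj A) a
     else iter k (@ladj A) a * iter k (@ladj A) b).
  by elim: k => //= k ->; case: odd; rewrite /= ladj_mul.
have itr k a b : iter k (@radj A) (a * b) =
    (if odd k then iter k (@radj A) b * iter k (@radj A) a
     else iter k (@radj A) a * iter k (@radj A) b).
  by elim: k => //= k ->; case: odd; rewrite /= radj_mul.
by move=> a b /periodicP pa /periodicP pb; apply/periodicP; rewrite itl itr pa pb.
Qed.
Lemma periodic_ladj a : a \in periodic -> ladj a \in periodic.
Proof.
have comm k : iter k (@radj A) (ladj a) = ladj (iter k (@radj A) a).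
  by elim: k => //= k ->; rewrite ladjK radjK.
by move=> /periodicP pa; apply/periodicP; rewrite comm -iterSr iterS pa.
Qed.
Lemma periodic_radj a : a \in periodic -> radj a \in periodic.
Proof.
have comm k : iter k (@ladj A) (radj a) = radj (iter k (@ladj A) a).
  by elim: k => //= k ->; rewrite ladjK radjK.
by move=> /periodicP pa; apply/periodicP; rewrite comm -iterSr iterS pa.
Qed.

Record periodic_sub := PeriodicSub {
  periodic_val :> A;
  _ : periodic_val \in periodic
}.

HB.instance Definition _ := [isSub for periodic_val].
HB.instance Definition _ := [Choice of periodic_sub by <:].
HB.instance Definition _ := Order.SubChoice_isSubLattice.Build
  lpregroup_display A periodic lpregroup_display periodic_sub
  periodic_meet periodic_join.
HB.instance Definition _ := SubChoice_isSubMonoid.Build A periodic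
  periodic_sub (conj periodic_one periodic_mul).

Implicit Types u v : periodic_sub.

Definition periodic_sub_ladj u : periodic_sub :=
  PeriodicSub (periodic_ladj (valP u)).
Definition periodic_sub_radj u : periodic_sub :=
  PeriodicSub (periodic_radj (valP u)).

Lemma periodic_sub_mulg_mono u u' v v' :
  u <= u' -> v <= v' -> u * v <= u' * v'.
Proof. by rewrite -!Order.le_val !valM; exact: mulg_mono. Qed.
Lemma periodic_sub_ladj_mul_le1 u : periodic_sub_ladj u * u <= 1.
Proof. by rewrite -Order.le_val valM val1; exact: ladj_mul_le1. Qed.
Lemma periodic_sub_le1_mul_ladj u : 1 <= u * periodic_sub_ladj u.
Proof. by rewrite -Order.le_val valM val1; exact: le1_mul_ladj. Qed.
Lemma periodic_sub_mul_radj_le1 u : u * periodic_sub_radj u <= 1.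
Proof. by rewrite -Order.le_val valM val1; exact: mul_radj_le1. Qed.
Lemma periodic_sub_le1_radj_mul u : 1 <= periodic_sub_radj u * u.
Proof. by rewrite -Order.le_val valM val1; exact: le1_radj_mul. Qed.
HB.instance Definition _ := isLpregroup.Build periodic_sub
  periodic_sub_mulg_mono periodic_sub_ladj_mul_le1 periodic_sub_le1_mul_ladj
  periodic_sub_mul_radj_le1 periodic_sub_le1_radj_mul.

End Periodic.

Definition Fn (n : nat) : lpregroupType := periodic_sub FZ n.

(* Main.v *)
Require Import Defs.
From HB Require Import structures.
From mathcomp Require Import all_boot all_order all_algebra.
From mathcomp Require Import boolp classical_sets cardinality filter.
From mathcomp Require Import zify ring lra.

Set Implicit Arguments.
Unset Strict Implicit.
Unset Printing Implicit Defensive.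

Import Order.TTheory GRing.Theory Num.Theory.

(** The statement reduces to the case [M = Fn n].  The functor that sends [M]
    to [lexprod H M] preserves surjections and embeddings, and [lexprod H] of a
    nonempty product embeds into the product of the [lexprod H (A i)]; so, by
    induction on the generation of the variety, it is enough to place
    [lexprod H (Fn n)] in the variety generated by [Fn n].

    In [Fn n] the translations [x |-> x + n k] are invertible and central
    ([periodic_shiftz]: a periodic map commutes with them), and for any two
    periodic maps [f], [g] the translate of [g] by [n k] lies strictly above
    [f] as soon as [k] is large ([periodic_bounded]).  Suppose first that [H]
    is the group of integers.  The element [(h, f)] is then represented by the
    sequence whose [i]-th entry is [f] followed by the translation by
    [n i h]: the sequences representing elements with different first
    coordinates get arbitrarily far apart, so that lattice operations on them
    are, for large [i], computed by comparing these coordinates, exactly as in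
    the lexicographic order.

    For general [H] the multiples [i h] are replaced by values [phi i h] of
    integer functions that are additive at any given pair of elements, and
    large at any given element above 1, for all [i] far enough along some
    filter ([asymptotic_embedding]).  They come from [positive_functional]: on
    a finitely generated subgroup of a partially ordered abelian group there is
    an integer-valued additive map taking positive values at finitely many
    prescribed positive elements.

    The families eventually equal to a representing sequence form a subalgebra
    of a power of [Fn n], and sending a family to the element that it
    represents is a surjective homomorphism ([variety_relation],
    [variety_lexprod]). *)

(** * Integer functionals positive on finitely many elements *)

Section PositiveFunctionals.
Local Open Scope ring_scope.

Lemma exists_between (R : realFieldType) (L U : seq R) :
  (forall l u, l \in L -> u \in U -> l < u) ->
  exists r, (forall l, l \in L -> l < r) /\ (forall u, u \in U -> r < u).
Proof.
have below (V : seq R) : exists r, forall u, u \in V -> r < u.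
  elim: V => [|v V [r hr]]; first by exists 0.
  exists (Num.min r (v - 1)) => u; rewrite inE gt_min => /predU1P[->|/hr->//].
  by rewrite ltrBlDr ltrDl ltr01 orbT.
have above l (V : seq R) : (forall u, u \in V -> l < u) ->
    exists r, l < r /\ forall u, u \in V -> r < u.
  elim: V => [|v V IH] hV; first by exists (l + 1); rewrite ltrDl ltr01.
  have [u uV|r [lr hr]] := IH; first by rewrite hV // inE uV orbT.
  have lv : l < v by rewrite hV ?mem_head.
  exists (Num.min r ((l + v) / 2)); rewrite lt_min lr midf_lt //; split=> // u.
  by rewrite inE gt_min => /predU1P[->|/hr->//]; rewrite midf_lt ?orbT.
elim: L => [|l L IH] LU; first by have [r hr] := below U; exists r.
have [k u kL|r [Lr rU]] := IH; first by apply: LU; rewrite inE kL orbT.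
have [lr|rl] := ltP l r.
  by exists r; split=> // k; rewrite inE => /predU1P[->|/Lr].
have [u|s [ls sU]] := above l U; first by apply: LU; rewrite mem_head.
exists s; split=> // k; rewrite inE => /predU1P[->//|/Lr kr].
exact: lt_trans kr (le_lt_trans rl ls).
Qed.

(** One step of Fourier-Motzkin elimination: a ratio [X / N] of the two
    coefficients has to satisfy one strict bound for each [p] with [j p <> 0],
    a lower or an upper one according to the sign of [j p], and the second
    hypothesis says that every lower bound is below every upper bound. *)
Lemma fourier_motzkin (T : eqType) (a j : T -> int) (ps : seq T) :
  (forall p, p \in ps -> j p = 0 -> 0 < a p) ->
  (forall p q, p \in ps -> q \in ps -> 0 < j p -> j q < 0 ->
    0 < a q * j p - a p * j q) ->
  exists N X : int, forall p, p \in ps -> 0 < a p * N + j p * X.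
Proof.
move=> h0 hpn.
pose bound p : rat := - (a p)%:~R / (j p)%:~R.
have [l u|r [Lr rU]] := @exists_between rat
    [seq bound p | p <- ps & 0 < j p] [seq bound p | p <- ps & j p < 0].
  case/mapP=> p; rewrite mem_filter => /andP[jp pps] ->.
  case/mapP=> q; rewrite mem_filter => /andP[jq qps] ->.
  have := hpn p q pps qps jp jq; rewrite -(ltr_int rat) rmorphB !rmorphM /=.
  have {}jp : 0 < (j p)%:~R :> rat by rewrite ltr0z.
  have {}jq : (j q)%:~R < 0 :> rat by rewrite ltrz0.
  move=> hpq.
  rewrite /bound ltr_pdivrMr // mulrAC ltr_ndivlMr // !mulNr ltrN2.
  by rewrite -subr_gt0.
exists (denq r), (numq r) => p pps.
rewrite -(ltr_int rat) rmorphD !rmorphM /=.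
have d0 : 0 < (denq r)%:~R :> rat by rewrite ltr0z denq_gt0.
rewrite -(pmulr_lgt0 _ (x := (denq r)%:~R^-1)) ?invr_gt0 // mulrDl -!mulrA.
rewrite divq_num_den divff ?gt_eqF // mulr1.
have [jp|jp|jp] := ltgtP (j p) 0.
- have := rU (bound p); rewrite (map_f bound) ?mem_filter ?jp // => /(_ isT).
  rewrite /bound ltr_ndivlMr ?ltrz0 // => h; lra.
- have := Lr (bound p); rewrite (map_f bound) ?mem_filter ?jp // => /(_ isT).
  rewrite /bound ltr_pdivrMr ?ltr0z // => h; lra.
- by rewrite jp mul0r addr0 ltr0z h0.
Qed.

(** The subgroup generated by [s], presented so that adjoining one more
    generator is one step of the recursion; [positive_functional] extends
    a functional along that step. *)
Fixpoint spanned (V : zmodType) (s : seq V) (x : V) : Prop :=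
  if s is v :: t then exists k : int, spanned t (x - v *~ k) else x = 0.

Section Span.
Variable V : zmodType.
Implicit Types (s : seq V) (x y : V).

Lemma spanned0 s : spanned s 0.
Proof. by elim: s => //= v s IH; exists 0; rewrite subr0. Qed.

Lemma spannedB s x y : spanned s x -> spanned s y -> spanned s (x - y).
Proof.
elim: s x y => [x y -> ->|v s IH x y [k hk] [l hl]] /=; first exact: subrr.
exists (k - l); rewrite mulrzBr.
have -> : x - y - (v *~ k - v *~ l) = x - v *~ k - (y - v *~ l); last exact: IH.
by rewrite !opprD !opprK addrACA.
Qed.

Lemma spannedD s x y : spanned s x -> spanned s y -> spanned s (x + y).
Proof.
move=> hx hy; rewrite -[y]opprK; apply: spannedB => //.
by rewrite -sub0r; apply: spannedB => //; exact: spanned0.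
Qed.

Lemma spannedMz s x (k : int) : spanned s x -> spanned s (x *~ k).
Proof.
move=> hx; case: k => k; elim: k => [|k IH].
- exact: spanned0.
- by rewrite -addn1 PoszD mulrzDr; apply: spannedD.
- by rewrite NegzE mulrNz mulr1z -sub0r; apply: spannedB => //; exact: spanned0.
- have -> : Negz k.+1 = Negz k - 1 by lia.
  by rewrite mulrzBr; apply: spannedB.
Qed.

Lemma mem_spanned s x : x \in s -> spanned s x.
Proof.
elim: s => //= v s IH; rewrite inE => /predU1P[->|/IH hx].
  by exists 1; rewrite mulr1z subrr; exact: spanned0.
by exists 0; rewrite mulr0z subr0.
Qed.

(* [P] is the strictly positive cone of a partial order on [V]. *)
Variable P : V -> Prop.
Hypothesis P0 : ~ P 0.
Hypothesis PD : forall x y, P x -> P y -> P (x + y).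

Lemma coneMz x (k : int) : 0 < k -> P x -> P (x *~ k).
Proof.
case: k => // -[//|k] _ Px; elim: k => // k IH.
by rewrite -addn1 PoszD mulrzDr; apply: PD.
Qed.

(** A functional with the required signs is extended one generator [v] at a
    time.  If some multiple [v *~ k] with [0 < k] already lies in the span of
    [s], then [x |-> phi (x *~ k)] is an extension.  Otherwise every [x] has a
    well-defined coordinate [j x] along [v], and an extension has the form
    [phi (rest x) * N + j x * X] where [rest x] is the component in the span of
    [s]; suitable [N] and [X] exist by [fourier_motzkin] once [phi] is
    positive on the positive combinations of prescribed elements in which [v]
    cancels. *)
Lemma positive_functional s (ps : seq V) :
  (forall p, p \in ps -> spanned s p /\ P p) ->
  exists phi : V -> int,
    (forall x y, spanned s x -> spanned s y -> phi (x + y) = phi x + phi y) /\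
    (forall p, p \in ps -> 0 < phi p).
Proof.
elim: s ps => [|v s IH] ps hps.
  exists (fun=> 0); split=> [|p /hps[/= -> ]] //.
have [[k [k0 vk]]|indep] :=
    pselect (exists k : int, 0 < k /\ spanned s (v *~ k)).
  have sub x : spanned (v :: s) x -> spanned s (x *~ k).
    case=> l /(@spannedMz _ _ k) hl.
    rewrite -(subrK (v *~ k *~ l) (x *~ k)); apply: spannedD.
      by rewrite -!mulrzA (mulrC k) mulrzA -mulrzBl.
    exact: spannedMz.
  have [q /mapP[p /hps[sp Pp] ->]|phi [phiD phi0]] := IH [seq p *~ k | p <- ps].
    by split; [exact: sub | exact: coneMz].
  exists (fun x => phi (x *~ k)); split=> [x y /sub hx /sub hy|p pps].
    by rewrite mulrzDl phiD.
  by apply: phi0; rewrite (map_f (fun x => x *~ k)).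
have {}indep k : spanned s (v *~ k) -> k = 0.
  move=> hk; apply: contrapT => k0; apply: indep.
  have [k_gt0|k_le0] := ltP 0 k; first by exists k.
  exists (- k); split; first lia.
  by rewrite mulrNz -sub0r; apply: spannedB => //; exact: spanned0.
pose j x : int := xget 0 [set k | spanned s (x - v *~ k)]%classic.
have jP x : spanned (v :: s) x -> spanned s (x - v *~ j x).
  by move=> hx; apply: (xgetPex 0 hx).
have jE x k : spanned s (x - v *~ k) -> j x = k.
  move=> hk; apply/eqP; rewrite -subr_eq0; apply/eqP; apply: indep.
  rewrite mulrzBr; have := spannedB hk (jP x (ex_intro _ k hk)).
  by rewrite opprB addrC addrA subrK.
have jD x y : spanned (v :: s) x -> spanned (v :: s) y -> j (x + y) = j x + j y.
  move=> /jP hx /jP hy; apply: jE.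
  by rewrite mulrzDr opprD addrACA; apply: spannedD.
pose rest x := x - v *~ j x.
pose comb p q := q *~ j p - p *~ j q.
have combE p q : comb p q = rest q *~ j p - rest p *~ j q.
  by rewrite /comb /rest !mulrzBl -!mulrzA (mulrC (j p)) opprB addrA subrK.
have [|phi [phiD phi0]] := IH ([seq p <- ps | j p == 0] ++
    [seq comb p q | p <- [seq p <- ps | 0 < j p],
                    q <- [seq q <- ps | j q < 0]]).
  move=> p; rewrite mem_cat => /orP[|/allpairsP[[p1 p2] /= []]].
    rewrite mem_filter => /andP[/eqP jp /hps[/jP hp Pp]]; split=> //.
    by rewrite jp mulr0z subr0 in hp.
  rewrite !mem_filter => /andP[j1 /hps[sp1 Pp1]] /andP[j2 /hps[sp2 Pp2]] ->.
  split; first by rewrite combE; apply: spannedB; apply/spannedMz/jP.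
  by rewrite /comb -mulrNz; apply: PD; apply: coneMz; rewrite // oppr_gt0.
have phi00 : phi 0 = 0.
  by apply: (addrI (phi 0)); rewrite -phiD ?addr0 //; exact: spanned0.
have phiN x : spanned s x -> phi (- x) = - phi x.
  move=> hx; apply/eqP; rewrite -addr_eq0 -phiD ?addNr ?phi00 //.
  by rewrite -sub0r; apply: spannedB => //; exact: spanned0.
have phiMz x (k : int) : spanned s x -> phi (x *~ k) = phi x * k.
  move=> hx; have phiMn (m : nat) : phi (x *+ m) = phi x * m%:Z.
    elim: m => [|m IHm]; first by rewrite mulr0n phi00 mulr0.
    rewrite mulrS phiD // ?IHm; first by rewrite intS mulrDr mulr1.
    exact: (spannedMz (Posz m)).
  case: k => k; first by rewrite -phiMn.
  rewrite NegzE mulrNz phiN ?mulrN -?phiMn //.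
  exact: (spannedMz (Posz k.+1)).
have [p pps jp|p q pps qps jp jq|N [X NX]] :=
    @fourier_motzkin _ (fun p => phi (rest p)) j ps.
- rewrite /rest jp mulr0z subr0; apply: phi0.
  by rewrite mem_cat mem_filter jp eqxx pps.
- have [[/jP sp _] [/jP sq _]] := (hps p pps, hps q qps).
  rewrite -!phiMz // -phiN; last exact: spannedMz.
  rewrite -phiD; last 1 first.
  + by rewrite -sub0r; apply: spannedB; [exact: spanned0 | exact: spannedMz].
  + rewrite -combE; apply: phi0; rewrite mem_cat; apply/orP; right.
    by apply/allpairsP; exists (p, q); rewrite /= !mem_filter jp jq pps qps.
  + exact: spannedMz.
- exists (fun x => phi (rest x) * N + j x * X); split=> // x y sx sy.
  have -> : rest (x + y) = rest x + rest y.
    by rewrite /rest jD // mulrzDr opprD addrACA.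
  by rewrite jD // phiD; [ring|exact: jP..].
Qed.

End Span.
End PositiveFunctionals.

(** * Totally ordered abelian groups are asymptotically integer-valued *)

(** A copy of [H] in additive notation, which provides its integer multiples. *)
Definition additive_group (H : totalLgroupType)
  (H_abelian : forall x y : H, (x * y = y * x)%g) : Type := H.

Section AdditiveGroup.
Variables (H : totalLgroupType).
Hypothesis H_abelian : forall x y : H, (x * y = y * x)%g.

HB.instance Definition _ :=
  Choice.copy (additive_group H_abelian) H.
HB.instance Definition _ := GRing.isZmodule.Build (additive_group H_abelian)
  (@mulgA H) H_abelian (@mul1g H) (@mulVg H).

Local Open Scope group_scope.
Local Open Scope order_scope.

Lemma mulg_gt1 (x y : H) : 1 < x -> 1 < y -> 1 < x * y.
Proof.
move=> x1 y1; apply: lt_le_trans x1 _.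
by rewrite -[leLHS]mulg1 mulg_mono // ltW.
Qed.

Lemma lt_mulVg (x y : H) : x < y -> 1 < x^-1 * y.
Proof.
move=> xy; rewrite lt_neqAle -{2}(mulVg x) mulg_mono ?(ltW xy) ?andbT //.
apply: contraTneq xy => /(congr1 (fun z => x * z)).
by rewrite mulg1 mulVKg => ->; rewrite ltxx.
Qed.

(** The additivity of the functional on the whole span of [L] covers the
    product of two elements of [L]; multiplying it by [C] turns positive values
    into values at least [C]. *)
Lemma local_embedding (L : seq H) (C : nat) : exists phi : H -> int,
  {in L &, forall x y, phi (x * y) = (phi x + phi y)%R} /\
  {in L, forall x, 1 < x -> (C%:Z)%R <= phi x}.
Proof.
have [||p|phi [phiD phi0]] := @positive_functional (additive_group H_abelian)
  (fun x => (1 : H) < x) _ _ L [seq x <- L | (1 : H) < x].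
- by rewrite ltxx.
- exact: mulg_gt1.
- by rewrite mem_filter => /andP[p1 pL]; split => //; exact: mem_spanned.
exists (fun x => (C%:Z * phi x)%R); split => [x y xL yL|x xL x1].
  by rewrite -mulrDr; congr (_ * _)%R; apply: phiD; exact: mem_spanned.
have := phi0 x; rewrite mem_filter x1 xL => /(_ isT); nia.
Qed.

(** The index [(L, C)] carries a function given by [local_embedding], and the
    filter lets [L] grow through the finite subsets of [H] and [C] grow to
    infinity.  In other words, [H] embeds into a reduced power of the integers
    in such a way that positive elements become infinitely large. *)
Lemma asymptotic_embedding : exists (I : Type) (F : set_system I)
    (phi : I -> H -> int), ProperFilter F /\
  (forall x y, \forall i \near F, phi i (x * y) = (phi i x + phi i y)%R) /\
  (forall x (C : int), 1 < x -> \forall i \near F, C <= phi i x).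
Proof.
pose base (d : seq H * nat) :=
  [set i : seq H * nat | {subset d.1 <= i.1} /\ (d.2 <= i.2)%N]%classic.
have [phi hphi] := choice (fun i : seq H * nat => local_embedding i.1 i.2).
exists (seq H * nat)%type, (filter_from setT base), phi; split.
  apply: filter_from_proper => [|d _]; last by exists d; split.
  apply: filter_from_filter; first by exists ([::], 0%N).
  move=> d e _ _; exists (d.1 ++ e.1, maxn d.2 e.2) => // i [/= sub le].
  move: le; rewrite geq_max => /andP[led lee].
  by split; split=> // x xd; apply: sub; rewrite mem_cat xd ?orbT.
split => [x y|x C x1].
  exists ([:: x; y], 0%N) => // i [/= sub _].
  by have [hD _] := hphi i; apply: hD; apply: sub; rewrite !inE eqxx ?orbT.
exists ([:: x], absz C) => // i [/= sub le].
have [_ /(_ x)] := hphi i; rewrite sub ?inE // => /(_ isT x1); lia.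
Qed.

End AdditiveGroup.

(** * Quotients of subalgebras *)

Section Varieties.
Local Open Scope group_scope.
Local Open Scope order_scope.

Record subalgebra (A : lpregroupType) (D : {pred A}) : Prop := Subalgebra {
  sub_meet : {in D &, forall a b, a `&` b \in D};
  sub_join : {in D &, forall a b, a `|` b \in D};
  sub_mul : {in D &, forall a b, a * b \in D};
  sub_one : 1 \in D;
  sub_ladj : {in D, forall a, ladj a \in D};
  sub_radj : {in D, forall a, radj a \in D}
}.

(** The closure proof is a parameter of the type because the algebraic
    structure of the subtype is built from it. *)
Record sub_lpregroup (A : lpregroupType) (D : {pred A})
  (closed : subalgebra D) := SubLpregroup { sub_val :> A; _ : sub_val \in D }.

Section Sub.
Variables (A : lpregroupType) (D : {pred A}) (closed : subalgebra D).
Local Notation S := (sub_lpregroup closed).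

HB.instance Definition _ := [isSub for @sub_val A D closed].
HB.instance Definition _ := [Choice of S by <:].
HB.instance Definition _ := Order.SubChoice_isSubLattice.Build
  lpregroup_display A D lpregroup_display S (sub_meet closed) (sub_join closed).
HB.instance Definition _ := SubChoice_isSubMonoid.Build A D S
  (conj (sub_one closed) (sub_mul closed)).

Implicit Types u v : S.

Definition sub_ladj_op u : S := SubLpregroup closed (sub_ladj closed (valP u)).
Definition sub_radj_op u : S := SubLpregroup closed (sub_radj closed (valP u)).

Lemma sub_mulg_mono u u' v v' : u <= u' -> v <= v' -> u * v <= u' * v'.
Proof. by rewrite -!Order.le_val !valM; exact: mulg_mono. Qed.
Lemma sub_ladj_mul_le1 u : sub_ladj_op u * u <= 1.
Proof. by rewrite -Order.le_val valM val1; exact: ladj_mul_le1. Qed.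
Lemma sub_le1_mul_ladj u : 1 <= u * sub_ladj_op u.
Proof. by rewrite -Order.le_val valM val1; exact: le1_mul_ladj. Qed.
Lemma sub_mul_radj_le1 u : u * sub_radj_op u <= 1.
Proof. by rewrite -Order.le_val valM val1; exact: mul_radj_le1. Qed.
Lemma sub_le1_radj_mul u : 1 <= sub_radj_op u * u.
Proof. by rewrite -Order.le_val valM val1; exact: le1_radj_mul. Qed.
HB.instance Definition _ := isLpregroup.Build S sub_mulg_mono
  sub_ladj_mul_le1 sub_le1_mul_ladj sub_mul_radj_le1 sub_le1_radj_mul.

Lemma sub_val_morphism : lpregroup_morphism (@sub_val A D closed : S -> A).
Proof.
by split.
Qed.

End Sub.

Record lpregroup_relation (A B : lpregroupType) (R : A -> B -> Prop) : Prop := {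
  rel_meet : forall a a' b b', R a b -> R a' b' -> R (a `&` a') (b `&` b');
  rel_join : forall a a' b b', R a b -> R a' b' -> R (a `|` a') (b `|` b');
  rel_mul : forall a a' b b', R a b -> R a' b' -> R (a * a') (b * b');
  rel_one : R 1 1;
  rel_ladj : forall a b, R a b -> R (ladj a) (ladj b);
  rel_radj : forall a b, R a b -> R (radj a) (radj b)
}.

(** The elements of [A] that are related to something form a subalgebra, and
    [R] restricts to the graph of a homomorphism from it onto [B].  Working
    with the relation avoids forming the reduced power of [B] as a quotient
    type. *)
Lemma variety_relation K (A B : lpregroupType) (R : A -> B -> Prop) :
  lpregroup_relation R -> (forall a b b', R a b -> R a b' -> b = b') ->
  (forall b, exists a, R a b) -> variety_of K A -> variety_of K B.
Proof.
move=> Rrel Rfun Ronto KA.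
pose D : {pred A} := [pred a | `[< exists b, R a b >]].
have closed : subalgebra D.
  split=> [a a'|a a'|a a'||a|a]; rewrite ?inE.
  - move=> [b ab] [b' ab']; exists (b `&` b').
    exact: rel_meet.
  - move=> [b ab] [b' ab']; exists (b `|` b').
    exact: rel_join.
  - move=> [b ab] [b' ab']; exists (b * b').
    exact: rel_mul.
  - by exists 1; exact: rel_one.
  - by move=> [b ab]; exists (ladj b); exact: rel_ladj.
  - by move=> [b ab]; exists (radj b); exact: rel_radj.
have KS : variety_of K (sub_lpregroup closed).
  exact: variety_sub (sub_val_morphism closed) val_inj KA.
have [|f fP] :=
    @choice _ _ (fun (u : sub_lpregroup closed) b => R (sub_val u) b).
  by move=> u; apply/asboolP; exact: (valP u).
have [vI vU vM v1 vl vr] := sub_val_morphism closed.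
apply: (@variety_image K _ B f) KS => [|b].
  split=> [u v|u v|u v||u|u]; apply: (Rfun _ _ _ (fP _)).
  - by rewrite vI; apply: rel_meet.
  - by rewrite vU; apply: rel_join.
  - by rewrite vM; apply: rel_mul.
  - by rewrite v1; apply: rel_one.
  - by rewrite vl; apply: rel_ladj.
  - by rewrite vr; apply: rel_radj.
have [a ab] := Ronto b.
have aD : a \in D by apply/asboolP; exists b.
exists (SubLpregroup closed aD).
exact: (Rfun a _ _ (fP (SubLpregroup closed aD)) ab).
Qed.

End Varieties.

(** * Lexicographic products over an algebra with central translations *)

Section StrongUnit.
Local Open Scope group_scope.
Local Open Scope order_scope.

(** [T] makes the integers act on [B] as powers of an invertible central
    element that is a strong unit: its powers eventually exceed everything. *)
Record central_translations (B : lpregroupType) (T : int -> B) : Prop := {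
  transD : forall k l, T (k + l)%R = T k * T l;
  trans0 : T 0%R = 1;
  transC : forall k b, T k * b = b * T k;
  trans_large : forall a b, exists C : int, forall k, C <= k -> a < T k * b
}.

Section Translations.
Variables (B : lpregroupType) (T : int -> B).
Hypothesis hT : central_translations T.
Implicit Types (k l : int) (a b : B).

Lemma transK k : cancel (fun b => T k * b) (fun b => T (- k)%R * b).
Proof. by move=> b; rewrite mulgA -(transD hT) addNr (trans0 hT) mul1g. Qed.

Lemma transNK k : cancel (fun b => T (- k)%R * b) (fun b => T k * b).
Proof. by move=> b; rewrite mulgA -(transD hT) subrr (trans0 hT) mul1g. Qed.

Lemma le_transE k a b : (T k * a <= b) = (a <= T (- k)%R * b).
Proof.
apply/idP/idP => h; first by rewrite -(transK k a) mulg_mono.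
by rewrite -(transNK k b) mulg_mono.
Qed.

Lemma ladj_trans k : ladj (T k) = T (- k)%R.
Proof. by apply: eq_mulg_le => a b; rewrite ladj_mulE le_transE opprK. Qed.

Lemma radj_trans k : radj (T k) = T (- k)%R.
Proof. by have := ladjK (T (- k)%R); rewrite ladj_trans opprK. Qed.

Lemma trans_meet k a b : T k * (a `&` b) = (T k * a) `&` (T k * b).
Proof.
apply/le_anti/andP; split; first by rewrite lexI !mulg_mono ?leIl ?leIr.
suff : T (- k)%R * ((T k * a) `&` (T k * b)) <= a `&` b.
  by rewrite le_transE opprK.
by rewrite lexI !le_transE opprK leIl leIr.
Qed.

Lemma trans_join k a b : T k * (a `|` b) = (T k * a) `|` (T k * b).
Proof.
apply/le_anti/andP; split; last by rewrite leUx !mulg_mono ?leUl ?leUr.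
by rewrite le_transE leUx -!le_transE leUl leUr.
Qed.

Lemma trans_lt k a b : a < T k * b -> forall l, T l * a < T (l + k)%R * b.
Proof.
move=> ab l; rewrite (transD hT) -mulgA lt_neqAle mulg_mono ?(ltW ab) // andbT.
by apply: contraTneq ab => /(can_inj (transK l)) <-; rewrite ltxx.
Qed.

Variable H : totalLgroupType.
Hypothesis H_abelian : forall x y : H, x * y = y * x.

(** An element [(h, b)] is represented by the family [T (phi i h) * b].  By
    [sep], representatives of elements with different first coordinates are
    eventually strictly ordered as these coordinates are; hence a family
    represents at most one element, and lattice operations on families follow
    the lexicographic ones.  When the first coordinates agree, the common
    factor [T (phi i h)] is central and invertible, and all operations pass
    through it. *)
Lemma variety_lexprod (K : lpregroupType -> Prop) :
  variety_of K B -> variety_of K (lexprod H B).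
Proof.
move=> KB.
have [I [F [phi [FF [phiM phi_large]]]]] := asymptotic_embedding H_abelian.
pose s (p : lexprod H B) : prod_lpregroup (fun _ : I => B) :=
  fun i => T (phi i p.1) * p.2.
pose R (a : prod_lpregroup (fun _ : I => B)) (p : lexprod H B) :=
  \forall i \near F, a i = s p i.
have sep (p q : lexprod H B) : p.1 < q.1 -> \forall i \near F, s p i < s q i.
  move=> pq; have [C hC] := trans_large hT p.2 q.2.
  have := phi_large _ C (lt_mulVg pq); have := phiM p.1 (p.1^-1 * q.1).
  apply: filterS2 => i; rewrite mulVKg => eM le; rewrite /s eM.
  exact/trans_lt/hC.
have phi1 : \forall i \near F, phi i 1 = 0%R.
  apply: filterS (phiM 1 1) => i; rewrite mulg1 => /esym/eqP.
  by rewrite -subr_eq0 addrK => /eqP.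
have phiV x : \forall i \near F, phi i x^-1 = (- phi i x)%R.
  by apply: filterS2 phi1 (phiM x x^-1) => i; rewrite mulgV => ->
    /esym/eqP; rewrite addrC addr_eq0 => /eqP.
have lt_le (p q : lexprod H B) : p.1 < q.1 -> p <= q.
  by move=> pq; rewrite lex_leE pq.
apply: (@variety_relation K (prod_lpregroup (fun _ : I => B)) _ R).
- split=> [a a' p q|a a' p q|a a' p q||a p|a p].
  + move=> ap a'q; have [pq|qp|e] := ltgtP p.1 q.1.
    * apply: filterS3 ap a'q (sep p q pq) => i ai a'i /ltW lt.
      rewrite (meet_l (lt_le _ _ pq)).
      change (a i `&` a' i = s p i).
      by rewrite ai a'i meet_l.
    * apply: filterS3 ap a'q (sep q p qp) => i ai a'i /ltW lt.
      rewrite (meet_r (lt_le _ _ qp)).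
      change (a i `&` a' i = s q i).
      by rewrite ai a'i meet_r.
    * have -> : p `&` q = (p.1, p.2 `&` q.2).
        by change (lex_meet p q = (p.1, p.2 `&` q.2)); rewrite /lex_meet e ltxx.
      apply: filterS2 ap a'q => i ai a'i.
      change (a i `&` a' i = T (phi i p.1) * (p.2 `&` q.2)).
      by rewrite ai a'i trans_meet /s e.
  + move=> ap a'q; have [pq|qp|e] := ltgtP p.1 q.1.
    * apply: filterS3 ap a'q (sep p q pq) => i ai a'i /ltW lt.
      rewrite (join_r (lt_le _ _ pq)).
      change (a i `|` a' i = s q i).
      by rewrite ai a'i join_r.
    * apply: filterS3 ap a'q (sep q p qp) => i ai a'i /ltW lt.
      rewrite (join_l (lt_le _ _ qp)).
      change (a i `|` a' i = s p i).
      by rewrite ai a'i join_l.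
    * have -> : p `|` q = (p.1, p.2 `|` q.2).
        by change (lex_join p q = (p.1, p.2 `|` q.2)); rewrite /lex_join e ltxx.
      apply: filterS2 ap a'q => i ai a'i.
      change (a i `|` a' i = T (phi i p.1) * (p.2 `|` q.2)).
      by rewrite ai a'i trans_join /s e.
  + move=> ap a'q; apply: filterS3 ap a'q (phiM p.1 q.1) => i ai a'i eM.
    change (a i * a' i = T (phi i (p.1 * q.1)) * (p.2 * q.2)).
    rewrite ai a'i eM (transD hT) /s !mulgA; congr (_ * _).
    by rewrite -!mulgA (transC hT _ p.2).
  + apply: filterS phi1 => i e1; change (1 = T (phi i 1) * 1).
    by rewrite e1 (trans0 hT) mul1g.
  + move=> ap; apply: filterS2 ap (phiV p.1) => i ai eV.
    change (ladj (a i) = T (phi i (ladj p.1)) * ladj p.2).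
    by rewrite ai ladjE eV ladj_mul ladj_trans (transC hT).
  + move=> ap; apply: filterS2 ap (phiV p.1) => i ai eV.
    change (radj (a i) = T (phi i (radj p.1)) * radj p.2).
    by rewrite ai radjE eV radj_mul radj_trans (transC hT).
- move=> a p q ap aq; have [pq|qp|e] := ltgtP p.1 q.1.
  + have /filter_ex[] // : \forall i \near F, False.
    by apply: filterS3 ap aq (sep p q pq) => i -> ->; rewrite ltxx.
  + have /filter_ex[] // : \forall i \near F, False.
    by apply: filterS3 ap aq (sep q p qp) => i -> ->; rewrite ltxx.
  + have /filter_ex[i] : \forall i \near F, p.2 = q.2.
      by apply: filterS2 ap aq => i ->; rewrite /s e => /(can_inj (transK _)).
    by case: p q e {ap aq} => [x b] [y c] /= -> ->.
- by move=> p; exists (s p); exact: nearW.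
- by apply: variety_prod.
Qed.
End Translations.
End StrongUnit.

(** * Central translations of periodic maps *)

Section PeriodicMaps.
Local Open Scope group_scope.
Local Open Scope order_scope.

Lemma FZ_ladjE (f : FZ) (p q : int) : (ladj f p <= q) = (p <= f q).
Proof.
have [le_f min_f] := FZ_ladj_funP f p; apply/idP/idP => [h|]; last exact: min_f.
exact: le_trans le_f (FZ_mono f h).
Qed.

(** Since [q <= ladj f p] is the negation of [p <= f (q - 1)], the double left
    adjoint is conjugation by the unit translation. *)
Lemma FZ_ladj2 (f : FZ) (x : int) : ladj (ladj f) x = (f (x - 1) + 1)%R.
Proof.
have E q : (ladj (ladj f) x <= q) = (f (x - 1)%R + 1 <= q)%R.
  rewrite FZ_ladjE; have := FZ_ladjE f q (x - 1)%R; lia.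
apply/le_anti; rewrite E lexx /= -E lexx //.
Qed.

(** Applying the left adjoint [n] more times to both sides of the periodicity
    equation gives that the [2n]-fold left adjoint of [f] is [f]; by
    [FZ_ladj2] it is the conjugate of [f] by the translation by [n]. *)
Lemma periodic_shift (n : nat) (f : FZ) (x : int) :
  f \in periodic n -> f (x + n%:Z)%R = (f x + n%:Z)%R.
Proof.
move=> /periodicP pf.
have ladj_radj k (g : FZ) : iter k (@ladj FZ) (iter k (@radj FZ) g) = g.
  by elim: k g => // k IH g; rewrite iterSr iterS radjK IH.
have even k y : iter (k + k) (@ladj FZ) f y = (f (y - k%:Z) + k%:Z)%R.
  elim: k y => [|k IH] y; first by rewrite subr0 addr0.
  rewrite addSn addnS !iterS FZ_ladj2 IH.
  by rewrite -addrA; congr (f _ + _)%R; lia.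
have := even n (x + n%:Z)%R; rewrite iterD pf ladj_radj => ->.
by rewrite addrK.
Qed.

Lemma periodic_shiftz (n : nat) (f : FZ) (x k : int) :
  f \in periodic n -> f (x + n%:Z * k)%R = (f x + n%:Z * k)%R.
Proof.
move=> pf; have shift y := periodic_shift y pf.
have pos (m : nat) y : f (y + n%:Z * m%:Z)%R = (f y + n%:Z * m%:Z)%R.
  elim: m => [|m IH]; first by rewrite mulr0 !addr0.
  by rewrite intS mulrDr mulr1 addrCA addrC shift IH; lia.
case: k => m; first exact: pos.
have := pos m.+1 (x + n%:Z * Negz m)%R.
have -> : (x + n%:Z * Negz m + n%:Z * m.+1%:Z)%R = x by lia.
lia.
Qed.

(** Reducing [x] modulo [n], both maps are controlled by their value at 0, up to
    an error [n] due to the remainder: monotonicity bounds [f] there by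
    [f n = f 0 + n] and [g] by [g 0]. *)
Lemma periodic_bounded (n : nat) (f g : FZ) : (0 < n)%N ->
  f \in periodic n -> g \in periodic n ->
  exists C : int, forall k : int, C <= k ->
    forall x : int, f x < (g x + n%:Z * k)%R.
Proof.
move=> n0 pf pg; exists (`|f 0 - g 0| + 2)%R => k Ck x.
have m0 : (0 <= x %% n)%Z%R by apply: modz_ge0; lia.
have mn : ((x %% n)%Z < n%:Z)%R by apply: ltz_pmod; lia.
rewrite (divz_eq x n) addrC [((x %/ n)%Z * _)%R]mulrC !periodic_shiftz //.
have f_ub := FZ_mono f (ltW mn); have g_lb := FZ_mono g m0.
have := periodic_shift 0%R pf; rewrite add0r => fn; rewrite fn in f_ub.
have bound (a b c d e m : int) : (0 < m -> `|c - d| + 2 <= k ->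
    a <= c + m -> d <= b -> a + m * e < b + m * e + m * k)%R by nia.
exact: bound _ Ck f_ub g_lb.
Qed.

Variable n : nat.

Lemma shift_mono k : {homo (fun x : int => x + k)%R : x y / x <= y}.
Proof. by move=> x y; rewrite lerD2r. Qed.
Lemma shift_finite (k x : int) :
  finite_set ((fun x : int => x + k)%R @^-1` [set x])%classic.
Proof.
apply: unbounded_finite x => [|q|q]; first exact: shift_mono.
  by exists (q - k)%R; lia.
by exists (q - k)%R; lia.
Qed.
Definition FZ_shift k : FZ := mkFZ (@shift_mono k) (@shift_finite k).

Lemma FZ_shiftD k l : FZ_shift (k + l)%R = FZ_shift k * FZ_shift l.
Proof. by apply: FZ_ext => x /=; lia. Qed.
Lemma FZ_shift0 : FZ_shift 0%R = 1.
Proof. by apply: FZ_ext => x /=; lia. Qed.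

Lemma ladj_shift k : ladj (FZ_shift k) = FZ_shift (- k)%R.
Proof.
apply: FZ_ext => x; apply/le_anti; rewrite FZ_ladjE /=.
have := FZ_ladjE (FZ_shift k) x (ladj (FZ_shift k) x); rewrite lexx /=; lia.
Qed.
Lemma radj_shift k : radj (FZ_shift k) = FZ_shift (- k)%R.
Proof. by have := ladjK (FZ_shift (- k)%R); rewrite ladj_shift opprK. Qed.

Lemma shift_periodic k : FZ_shift k \in periodic n.
Proof.
apply/periodicP; elim: n k => // m IH k.
by rewrite !iterSr ladj_shift radj_shift.
Qed.

Definition Fn_trans (k : int) : Fn n :=
  PeriodicSub (shift_periodic (n%:Z * k)%R).

Lemma Fn_central_translations : (0 < n)%N -> central_translations Fn_trans.
Proof.
move=> n0; split.
- by move=> k l; apply: val_inj; rewrite /= mulrDr FZ_shiftD.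
- by apply: val_inj; rewrite /= mulr0 FZ_shift0.
- move=> k f; apply: val_inj; apply: FZ_ext => x /=.
  by rewrite [(x + _)%R]addrC addrC -periodic_shiftz 1?addrC //; exact: valP.
- move=> f g; have [C hC] := periodic_bounded n0 (valP f) (valP g).
  exists C => k /hC lt; rewrite lt_neqAle; apply/andP; split.
    apply/eqP => /(congr1 (fun h : Fn n => val h 0%R)) /= e.
    by have := lt 0%R; rewrite e ltxx.
  by rewrite -Order.le_val; apply/FZ_leP => x; exact/ltW/lt.
Qed.

End PeriodicMaps.

(** * Lexicographic products and the operators generating a variety *)

Section LexicographicFunctor.
Local Open Scope group_scope.
Local Open Scope order_scope.
Variable H : totalLgroupType.

Definition lex_map (A B : lpregroupType) (f : A -> B) (p : lexprod H A) :
  lexprod H B := (p.1, f p.2).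

Lemma lex_map_morphism (A B : lpregroupType) (f : A -> B) :
  lpregroup_morphism f -> lpregroup_morphism (lex_map f).
Proof.
case=> fI fU fM f1 fl fr; split=> [p q|p q|p q||p|p]; rewrite /lex_map /=.
- change (((lex_meet p q).1, f (lex_meet p q).2) =
    lex_meet (lex_map f p) (lex_map f q)).
  by rewrite /lex_meet /=; case: ltgtP => //= _; rewrite fI.
- change (((lex_join p q).1, f (lex_join p q).2) =
    lex_join (lex_map f p) (lex_map f q)).
  by rewrite /lex_join /=; case: ltgtP => //= _; rewrite fU.
- by change ((p.1 * q.1, f (p.2 * q.2)) = lex_mul (lex_map f p) (lex_map f q));
    rewrite fM.
- by change ((1 : H, f 1) = lex_one H B); rewrite f1.
- by change ((ladj p.1, f (ladj p.2)) = lex_ladj (lex_map f p)); rewrite fl.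
- by change ((radj p.1, f (radj p.2)) = lex_radj (lex_map f p)); rewrite fr.
Qed.

Lemma lex_map_inj (A B : lpregroupType) (f : A -> B) :
  injective f -> injective (lex_map f).
Proof. by move=> fI [h a] [k b] [-> /fI ->]. Qed.

Lemma lex_map_onto (A B : lpregroupType) (f : A -> B) :
  (forall b, exists a, f a = b) -> forall q, exists p, lex_map f p = q.
Proof. by move=> fO [h b]; have [a <-] := fO b; exists (h, a). Qed.

Lemma lex_prod_morphism (I : Type) (A : I -> lpregroupType) :
  lpregroup_morphism (fun (p : lexprod H (prod_lpregroup A)) =>
    (fun i => (p.1, p.2 i)) : prod_lpregroup (fun i => lexprod H (A i))).
Proof.
have proj i : lpregroup_morphism (fun a : prod_lpregroup A => a i) by split.
split=> [p q|p q|p q||p|p]; apply: functional_extensionality_dep => i;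
  have [mI mU mM m1 ml mr] := lex_map_morphism (proj i).
- exact: mI.
- exact: mU.
- exact: mM.
- exact: m1.
- exact: ml.
- exact: mr.
Qed.

(** This serves the empty product, a one-element algebra: [lexprod H] of it is
    a copy of [H] and has to be embedded into [lexprod H (Fn n)] instead. *)
Lemma const1_morphism (A B : lpregroupType) : (forall a a' : A, a = a') ->
  lpregroup_morphism (fun _ : A => 1 : B).
Proof.
split=> // [a b|a b|a b|a|a]; rewrite ?meetxx ?joinxx ?mulg1 //.
- by rewrite ladj1.
- by rewrite radj1.
Qed.

End LexicographicFunctor.

Theorem proposition4p5 (n : nat) (n_gt1 : (1 < n)%N)
    (H : totalLgroupType) (H_abelian : forall x y : H, (x * y = y * x)%g)
    (M : lpregroupType) (M_in : variety_of (fun A => A = Fn n) M) :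
  variety_of (fun A => A = Fn n) (lexprod H M).
Proof.
have Fn_in : variety_of (fun A => A = Fn n) (lexprod H (Fn n)).
  apply: (variety_lexprod (Fn_central_translations _) H_abelian).
    exact: ltnW.
  exact: variety_gen.
elim: M_in => {M} [A ->|A B f fm fO _ IH|A B f fm fI _ IH|I A _ IH].
- exact: Fn_in.
- exact: variety_image (lex_map_morphism H fm) (lex_map_onto fO) IH.
- exact: variety_sub (lex_map_morphism H fm) (lex_map_inj fI) IH.
(* The first coordinate is recovered from any factor, hence the need for an
   index [i0]. *)
- have [[i0 _]|I0] := pselect (exists i : I, True).
    apply: variety_sub (lex_prod_morphism H A) _ (variety_prod IH).
    move=> [h a] [k b] e; have [ehk _] := congr1 (fun g => g i0) e.
    congr (_, _) => //; apply: functional_extensionality_dep => i.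
    by have [] := congr1 (fun g => g i) e.
  have triv (a b : prod_lpregroup A) : a = b.
    by apply: functional_extensionality_dep => i; case: I0; exists i.
  apply: variety_sub (lex_map_morphism H (const1_morphism (Fn n) triv)) _ Fn_in.
  by apply: lex_map_inj => a b _; exact: triv.
Qed.
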